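(* Let $G\in\mathcal{C}$ and let $(T,\chi)$ be a structured tree decomposition of $G$. Let $v\in V(T)$ and let $Y\subseteq\chi(v)$ be a stable set. Then there exist components $D_1,\dots,D_k$ of $G\setminus\chi(v)$, with $k\leq 4$, such that $Y\subseteq\bigcup_{i=1}^k N(D_i)$.
   Context: Graphs are finite and simple. A hole is an induced cycle on at least four vertices; a theta is three internally vertex-disjoint induced paths between two vertices, each of length at least 2, with pairwise anticomplete interiors; a prism consists of three vertex-disjoint induced paths $a_i\text{-}\dots\text{-}b_i$, each of length at least 1, with $a_1a_2a_3$, $b_1b_2b_3$ triangles and no other edges between them; a wheel $(H,x)$ is a hole $H$ and a vertex $x$ with at least three neighbors in $H$, even if that number is even. $\mathcal{C}$ is the class of graphs with no induced $C_4$, theta, prism or even wheel. A chordal completion of $G$ is a chordal graph $G+F$ obtained by adding a set $F$ of non-edges; it is minimal if $F$ is inclusion-wise minimal. A potential maximal clique (PMC) of $G$ is a set that is a maximal clique of some minimal chordal completion of $G$. A tree decomposition is structured if every bag is a PMC of $G$. $N(D)$ denotes the set of vertices outside $D$ with a neighbor in $D$.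
   Formalization: The formal statement adds the hypothesis that Y is not a single vertex {y} all of whose neighbors lie in χ(v); in that case (e.g. G complete with one bag) no component D of G∖χ(v) has y in N(D), so the claim as stated fails. *)

(* Defs.v *)
From mathcomp Require Import all_boot.

Set Implicit Arguments.
Unset Strict Implicit.
Unset Printing Implicit Defensive.

(* A finite simple graph is a symmetric irreflexive relation on a finType. *)
Definition simple_graph (V : finType) (e : rel V) : Prop :=
  symmetric e /\ irreflexive e.

(* The vertices of the cycle are listed in cyclic order; [next] is the cyclic
   successor, so the only edges among them are those of the cycle. *)
Definition induced_cycle (V : finType) (e : rel V) (c : seq V) : Prop :=
  [/\ 3 <= size c, uniq c
    & {in c &, forall x y, e x y = (y == next c x) || (x == next c y)}].

Definition hole (V : finType) (e : rel V) (c : seq V) : Prop :=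
  induced_cycle e c /\ 4 <= size c.

Definition induced_path (V : finType) (e : rel V) (p : seq V) : Prop :=
  uniq p /\
  {in p &, forall x y, e x y =
     (index y p == (index x p).+1) || (index x p == (index y p).+1)}.

Definition has_C4 (V : finType) (e : rel V) : Prop :=
  exists c : seq V, induced_cycle e c /\ size c = 4.

(* [p i] lists the interior of the i-th path, which is [a :: rcons (p i) b];
   length at least 2 means that the interior is nonempty. *)
Definition has_theta (V : finType) (e : rel V) : Prop :=
  exists (a b : V) (p : 'I_3 -> seq V),
    (forall i, induced_path e (a :: rcons (p i) b) /\ p i != [::]) /\
    (forall i j, i != j ->
       {in p i & p j, forall x y, x != y /\ ~~ e x y}).

(* [p i] lists the interior of the i-th path, from [a i] to [b i]; it may be
   empty, and the path has length at least 1 by construction. *)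
Definition has_prism (V : finType) (e : rel V) : Prop :=
  exists (a b : 'I_3 -> V) (p : 'I_3 -> seq V),
    let P i := a i :: rcons (p i) (b i) in
    (forall i, induced_path e (P i)) /\
    (forall i j, i != j ->
       {in P i & P j, forall x y, x != y /\
          e x y = ((x == a i) && (y == a j)) || ((x == b i) && (y == b j))}).

Definition has_even_wheel (V : finType) (e : rel V) : Prop :=
  exists (c : seq V) (x : V),
    [/\ hole e c, 3 <= count (e x) c & ~~ odd (count (e x) c)].

Definition classC (V : finType) (e : rel V) : Prop :=
  [/\ ~ has_C4 e, ~ has_theta e, ~ has_prism e & ~ has_even_wheel e].

Definition chordal (V : finType) (e : rel V) : Prop :=
  forall c : seq V, ~ hole e c.

Definition nonedges (V : finType) (e : rel V) : {set {set V}} :=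
  [set f : {set V} |
     [exists x, exists y, [&& x != y, ~~ e x y & f == [set x; y]]]].

Definition add_edges (V : finType) (e : rel V) (F : {set {set V}}) : rel V :=
  [rel x y | e x y || ([set x; y] \in F)].

Definition chordal_completion (V : finType) (e : rel V) (F : {set {set V}}) :
  Prop := F \subset nonedges e /\ chordal (add_edges e F).

Definition minimal_chordal_completion (V : finType) (e : rel V)
    (F : {set {set V}}) : Prop :=
  chordal_completion e F /\
  forall F' : {set {set V}}, chordal_completion e F' -> F' \subset F -> F' = F.

Definition clique (V : finType) (e : rel V) : pred {set V} :=
  [pred K : {set V} | [forall x in K, forall y in K, (x != y) ==> e x y]].

Definition stable (V : finType) (e : rel V) : pred {set V} :=
  [pred Y : {set V} | [forall x in Y, forall y in Y, ~~ e x y]].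

Definition pmc (V : finType) (e : rel V) (K : {set V}) : Prop :=
  exists F : {set {set V}},
    minimal_chordal_completion e F /\ maxset (clique (add_edges e F)) K.

Definition is_tree (T : finType) (t : rel T) : Prop :=
  [/\ simple_graph t, 0 < #|T|, forall u v, connect t u v
    & forall c : seq T, ucycle t c -> size c <= 2].

Definition tree_decomposition (V : finType) (e : rel V)
    (T : finType) (t : rel T) (chi : T -> {set V}) : Prop :=
  [/\ is_tree t,
      forall x : V, exists u, x \in chi u,
      forall x y : V, e x y -> exists u, (x \in chi u) && (y \in chi u)
    & forall (x : V) (u v : T), x \in chi u -> x \in chi v ->
        connect [rel a b | [&& x \in chi a, x \in chi b & t a b]] u v].

Definition structured (V : finType) (e : rel V)
    (T : finType) (chi : T -> {set V}) : Prop :=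
  forall u : T, pmc e (chi u).

(* Vertex sets of the connected components of the graph minus [X]. *)
Definition components (V : finType) (e : rel V) (X : {set V}) :
    {set {set V}} :=
  [set [set y | connect [rel a b | [&& a \notin X, b \notin X & e a b]] x y]
     | x in ~: X].

Definition nbh (V : finType) (e : rel V) (D : {set V}) : {set V} :=
  [set y in ~: D | [exists x in D, e x y]].

(* Main.v *)
Require Import Defs.
From mathcomp Require Import all_boot.

Set Implicit Arguments.
Unset Strict Implicit.
Unset Printing Implicit Defensive.

(* A non-adjacent pair x, y of a potential maximal clique K is attached to a
   common component of G minus K: otherwise, deleting from the minimal
   completion the fill edge xy and every fill edge not inside K or some D + N(D)
   leaves a chordal graph, since it is obtained by gluing chordal graphs along
   the cliques N(D).

   Let Y be a stable set containing a <> b.  If two components L, L' both attach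
   to a and b, then each c in Y attaches to L or L': otherwise L, L' and
   the route from a to b through c form a theta.  If no pair of Y is attached to
   two components, let L attach to a, b and take c in Y off N(L); then every d
   in Y attaches to L, to the component of {a, c}, or to that of {b, c}, as
   otherwise L and the routes through c and d form a theta. *)

(** * Shortening walks to induced paths, and assembling a theta *)

Section InducedPaths.
Variables (V : finType) (e : rel V).
Hypotheses (e_sym : symmetric e) (e_irr : irreflexive e).

(** Recursive form of [induced_path], suited to induction from the front vertex. *)
Fixpoint chordless (x : V) (s : seq V) : bool :=
  if s is y :: s' then
    [&& x \notin s, e x y, ~~ has (e x) s' & chordless y s']
  else true.

(** Shortcut from [x] straight to the last vertex of the path that equals [x] or is adjacent to it;
    no later vertex can then give a chord. *)
Lemma chordless_cons x y s :
    chordless y s -> has (fun z => (x == z) || e x z) (y :: s) ->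
  exists s', [/\ chordless x s', {subset s' <= y :: s}
                & last x s' = last y s].
Proof.
elim: s y => [|z s IHs] y.
  move=> _ /=; rewrite orbF => /orP[/eqP-> | exy].
    by exists [::].
  exists [:: y]; split => //=; rewrite exy inE !andbT.
  by apply: contraTneq exy => ->; rewrite e_irr.
move=> cys; have /and4P[_ _ _ czs] := cys.
have [xzs _ | nxzs] := boolP (has (fun z => (x == z) || e x z) (z :: s)).
  have [s' [cs' sub_s' ls']] := IHs z czs xzs; exists s'; split=> //.
  by move=> w /sub_s' ws; rewrite inE ws orbT.
rewrite [has _ _]/= -/(has _ (z :: s)) (negPf nxzs) orbF => /orP[/eqP-> | exy].
  by exists (z :: s); split=> // w ws; rewrite inE ws orbT.
exists [:: y, z & s]; split=> //.
rewrite [chordless x _]/= -/(chordless y (z :: s)) cys exy andbT.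
have x_neq_y : x != y by apply: contraTneq exy => ->; rewrite e_irr.
rewrite -/(has (e x) (z :: s)) in_cons (negPf x_neq_y) orFb andTb.
apply/andP; split; last first.
  by apply: contra nxzs => /hasP[w ws exw]; apply/hasP; exists w; rewrite ?exw ?orbT.
by apply: contra nxzs => xs; apply/hasP; exists x; rewrite ?eqxx.
Qed.

Lemma path_chordless x s : path e x s ->
  exists s', [/\ chordless x s', {subset s' <= s} & last x s' = last x s].
Proof.
elim: s x => [|y s IHs] x /=; first by exists [::].
case/andP=> exy /IHs[s1 [c1 sub1 l1]].
have [|s2 [c2 sub2 l2]] := @chordless_cons x y s1 c1.
  by rewrite /= exy orbT.
exists s2; split=> //; last by rewrite l2 l1.
move=> w /sub2; rewrite !inE => /orP[-> // | /sub1->]; exact: orbT.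
Qed.

Lemma chordless_induced x s : chordless x s -> induced_path e (x :: s).
Proof.
elim: s x => [|y s IHs] x.
  by split=> // u w; rewrite !inE => /eqP-> /eqP->; rewrite e_irr /= eqxx.
case/and4P=> xnot exy nxs /IHs[us adj].
have ex w : w \in y :: s -> e x w = (index w (y :: s) == 0).
  rewrite inE /= eq_sym; case: eqVneq => [<- // | _ /= ws].
  by apply: contraNF nxs => exw; apply/hasP; exists w.
split; first by rewrite cons_uniq xnot.
have idx w : w \in y :: s -> index w (x :: y :: s) = (index w (y :: s)).+1.
  by move=> ws; rewrite [LHS]/= ifN // ; apply: contraNneq xnot => ->.
have idxx : index x (x :: y :: s) = 0 by rewrite /= eqxx.
move=> u w; rewrite (in_cons x) => /predU1P[-> | us'];
  rewrite (in_cons x) => /predU1P[-> | ws'].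
- by rewrite e_irr idxx.
- by rewrite ex // idxx idx // eqSS orbF.
- by rewrite e_sym ex // idxx idx // eqSS.
- by rewrite adj // !idx // !eqSS.
Qed.

(** Only a walk is required, so links can be concatenated even when their sets overlap; repetitions
    and chords are removed in [linked_induced]. *)
Definition linked (S : {set V}) (a b : V) : Prop :=
  exists s, path e a (rcons s b) /\ {subset s <= S}.

Lemma linked_trans S S' a b c :
  linked S a c -> linked S' c b -> linked (c |: (S :|: S')) a b.
Proof.
move=> [s [ps sS]] [s' [ps' sS']]; exists (rcons s c ++ s').
rewrite rcons_cat cat_path ps last_rcons; split=> // z.
rewrite mem_cat mem_rcons !inE => /orP[/predU1P[->|/sS->] | /sS'->].
- by rewrite eqxx.
- by rewrite orbT.
- by rewrite !orbT.
Qed.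

Lemma linked_induced S a b : a != b -> ~~ e a b -> linked S a b ->
  exists p, [/\ induced_path e (a :: rcons p b), p != [::]
              & {subset p <= S}].
Proof.
move=> neq_ab nab [s [/path_chordless[s' [cs' sub ls']] sS]].
move: ls' cs' sub; rewrite last_rcons; case/lastP: s' => [|p b'] /=.
  by move=> ab; rewrite ab eqxx in neq_ab.
rewrite last_rcons => -> cs' sub.
have ind := chordless_induced cs'; exists p; split=> //.
  by apply: contraNneq nab => p0; move: cs'; rewrite p0 => /and4P[].
move=> z zp; have := sub z; rewrite !mem_rcons !inE zp orbT => /(_ isT).
case/predU1P=> [zb | /sS //].
by case: ind => /=; rewrite rcons_uniq -zb zp andbF.
Qed.

Definition anticomplete (S S' : {set V}) : Prop :=
  {in S & S', forall x y, x != y /\ ~~ e x y}.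

Lemma anticomplete_sym S S' : anticomplete S S' -> anticomplete S' S.
Proof. by move=> h x y xS yS'; rewrite eq_sym e_sym; apply: h. Qed.

Lemma anticompleteUr S S1 S2 :
  anticomplete S S1 -> anticomplete S S2 -> anticomplete S (S1 :|: S2).
Proof.
by move=> h1 h2 x y xS; rewrite inE => /orP[]; [apply: h1 | apply: h2].
Qed.

(** Each walk shortens to an induced path whose interior stays in its own set, so anticompleteness
    of the sets passes to the interiors. *)
Lemma linked_theta S0 S1 S2 a b : a != b -> ~~ e a b ->
    linked S0 a b -> linked S1 a b -> linked S2 a b ->
    anticomplete S0 S1 -> anticomplete S0 S2 -> anticomplete S1 S2 ->
  has_theta e.
Proof.
move=> neq_ab nab l0 l1 l2 h01 h02 h12.
have [p0 [i0 n0 s0]] := linked_induced neq_ab nab l0.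
have [p1 [i1 n1 s1]] := linked_induced neq_ab nab l1.
have [p2 [i2 n2 s2]] := linked_induced neq_ab nab l2.
exists a, b, (fun i : 'I_3 => nth [::] [:: p0; p1; p2] i); split.
  by case=> [[|[|[]]]].
have [h10 h20 h21] := And3 (anticomplete_sym h01) (anticomplete_sym h02)
                           (anticomplete_sym h12).
move=> [[|[|[|//]]] ?] [[|[|[|//]]] ?] //= _ x y.
- by move=> /s0 xs /s1 ys; apply: h01.
- by move=> /s0 xs /s2 ys; apply: h02.
- by move=> /s1 xs /s0 ys; apply: h10.
- by move=> /s1 xs /s2 ys; apply: h12.
- by move=> /s2 xs /s0 ys; apply: h20.
- by move=> /s2 xs /s1 ys; apply: h21.
Qed.

End InducedPaths.

(** * Components of the graph minus [X] and their attachments in [X] *)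

Section Components.
Variables (V : finType) (e : rel V) (X : {set V}).
Hypothesis (e_sym : symmetric e).

Let off : rel V := [rel a b | [&& a \notin X, b \notin X & e a b]].

Let off_sym : symmetric off.
Proof. by move=> a b; rewrite /off /= e_sym andbCA. Qed.

Let off_csym : connect_sym off.
Proof. exact: sym_connect_sym. Qed.

Lemma component_notin D x : D \in components e X -> x \in D -> x \notin X.
Proof.
case/imsetP=> z; rewrite inE => zX ->; rewrite inE => /connectP[s].
by elim: s z zX => [|y s IHs] z zX /=; [move=> _ -> | case/andP=> /and3P[_ yX _] /(IHs _ yX)].
Qed.

Lemma component_exists x : x \notin X -> exists2 D, D \in components e X & x \in D.
Proof.
move=> xX; exists [set y | connect off x y]; last by rewrite inE connect0.
by apply/imsetP; exists x; rewrite ?inE.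
Qed.

Lemma component_uniq D D' x : D \in components e X -> D' \in components e X ->
  x \in D -> x \in D' -> D = D'.
Proof.
case/imsetP=> z _ -> /imsetP[z' _ ->]; rewrite !inE => zx z'x.
apply/setP=> y; rewrite !inE (same_connect off_csym zx).
by rewrite (same_connect off_csym z'x).
Qed.

Lemma component_edge D x y : D \in components e X -> x \in D -> e x y ->
  (y \in D) || (y \in X) && (y \in nbh e D).
Proof.
move=> DC xD exy; have xX := component_notin DC xD.
have [yX | yX] := boolP (y \in X).
  have yD : y \notin D by apply: contraL yX; apply: component_notin.
  by rewrite (negPf yD) inE inE yD /=; apply/existsP; exists x; rewrite xD.
case/imsetP: DC xD => z _ ->; rewrite !inE => zx; rewrite (connect_trans zx) //.
by rewrite connect1 //= xX yX.
Qed.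

Lemma nbh_component D y : D \in components e X -> y \in nbh e D -> y \in X.
Proof.
move=> DC; rewrite !inE => /andP[yD /existsP[x /andP[xD exy]]].
by have := component_edge DC xD exy; rewrite (negPf yD) => /andP[].
Qed.

(** Neighbours of [a] and [b] in [D] are joined by a path avoiding [X], and such a path never leaves
    [D]. *)
Lemma component_linked D a b : D \in components e X ->
  a \in nbh e D -> b \in nbh e D -> linked e D a b.
Proof.
move=> DC; rewrite !inE => /andP[_ /existsP[x /andP[xD eax]]].
case/andP=> _ /existsP[y /andP[yD eyb]].
have xy : connect off x y.
  case/imsetP: DC xD yD => z _ ->; rewrite !inE => zx zy.
  by apply: connect_trans zy; rewrite off_csym.
case/connectP: xy => s ps ys.
have [pe sD] : path e x s /\ {subset x :: s <= D}.
  elim: s x xD ps {eax ys} => [|w s IHs] x xD /=.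
    by move=> _; split=> // z; rewrite inE => /eqP->.
  case/andP=> /and3P[xX wX exw] /IHs.
  have /orP[wD /(_ wD)[-> sD] | /andP[]] := component_edge DC xD exw.
    by rewrite exw; split=> // z; rewrite inE => /predU1P[->|/sD].
  by rewrite (negPf wX).
exists (x :: s); split=> //=; rewrite rcons_path pe -ys eyb e_sym eax //.
Qed.

Lemma components_anticomplete D D' : D \in components e X ->
  D' \in components e X -> D != D' -> anticomplete e D D'.
Proof.
move=> DC DC' neq x y xD yD'; split.
  by apply: contraNneq neq => xy; apply/eqP/(component_uniq (x:=x)); rewrite ?xy // -xy.
apply: contra neq => exy; apply/eqP/(component_uniq (x:=y)) => //.
have /orP[// | /andP[yX]] := component_edge DC xD exy.
by have := component_notin DC' yD'; rewrite yX.
Qed.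

Lemma component_anticomplete1 D c : D \in components e X -> c \in X ->
  c \notin nbh e D -> anticomplete e D [set c].
Proof.
move=> DC cX cN x y xD /set1P->; split.
  by apply: contraTneq cX => <-; apply: component_notin xD.
apply: contra cN => exc; have /orP[cD | /andP[] //] := component_edge DC xD exc.
by have := component_notin DC cD; rewrite cX.
Qed.

End Components.

(** * Index arithmetic on holes, and holes meeting a set attached to a clique *)

Section Holes.
Variables (V : finType) (e : rel V).

Lemma next_nth_mod (x0 : V) (c : seq V) i : uniq c -> i < size c ->
  next c (nth x0 c i) = nth x0 c (i.+1 %% size c).
Proof.
move=> uc lt_i; rewrite next_nth mem_nth //.
case: c uc lt_i => [//|y s] uc lt_i; rewrite index_uniq //.
rewrite /= ltnS leq_eqVlt in lt_i.
(* At the last index the lookup in [s] falls off the end; its default [y], the head of the cycle, is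
   the cyclic successor. *)
case/predU1P: lt_i => [-> | lt_i]; first by rewrite modnn nth_default.
by rewrite modn_small //=; apply: set_nth_default.
Qed.

Lemma hole_nth x0 c i j : hole e c -> i < size c -> j < size c ->
  e (nth x0 c i) (nth x0 c j) =
  (j == i.+1 %% size c) || (i == j.+1 %% size c).
Proof.
case=> -[_ uc adj] c4 lt_i lt_j; rewrite adj ?mem_nth // !next_nth_mod //.
by rewrite !nth_uniq // ltn_mod (leq_trans _ c4).
Qed.

Lemma hole_rot n c : hole e c -> hole e (rot n c).
Proof.
case=> -[c3 uc adj] c4; split; last by rewrite size_rot.
split; rewrite ?size_rot ?rot_uniq // => x y; rewrite !mem_rot => xc yc.
by rewrite !next_rot // adj.
Qed.

End Holes.

Lemma hole_eq_in (V : finType) (e e' : rel V) c :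
  {in c &, e =2 e'} -> hole e c -> hole e' c.
Proof.
move=> ee' [[c3 uc adj] c4]; split=> //; split=> // x y xc yc.
by rewrite -ee' // adj.
Qed.

(* Between leaving D and re-entering it, the hole visits N twice, at vertices
   that are not consecutive. *)
Lemma hole_attached_clique (V : finType) (h : rel V) (D N : {set V}) c d :
    (forall x y, x \in D -> h x y || h y x -> y \in D :|: N) ->
    {in N &, forall x y, x != y -> h x y} ->
    hole h c -> d \in c -> d \in D ->
  {subset c <= D :|: N}.
Proof.
move=> DN clN hc0 dc0 dD.
suff: forall c, hole h c -> nth d c 0 = d -> {subset c <= D :|: N}.
  case/rot_to: dc0 => i s Es sub z zc.
  by apply: (sub (rot i c)); rewrite ?mem_rot ?Es //= -Es; apply: hole_rot.
move=> {hc0 dc0}c hc c0 z /(nthP d)[k lt_k <-]; apply: contraT => nk.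
have c4 : 4 <= size c by case: hc.
have uc : uniq c by case: hc => [[]].
set n := size c in lt_k c4 *.
(* With [d] rotated to index 0, periodic indexing makes index [n] a second visit to [d], after
   [k]. *)
pose f m := nth d c (m %% n).
have n_gt0 : 0 < n by apply: leq_trans c4.
have f_adj m : h (f m) (f m.+1).
  rewrite /f hole_nth ?ltn_mod // -/n; apply/orP; left.
  by rewrite -addn1 -[(m %% n).+1]addn1 modnDml.
have fk : f k \notin D :|: N by rewrite /f modn_small.
have f0 : f 0 \in D by rewrite /f mod0n c0.
have fn : f n \in D by rewrite /f modnn c0.
have exl : exists m, (m <= k) && (f m \in D) by exists 0; rewrite f0.
have ubl m : (m <= k) && (f m \in D) -> m <= k by case/andP.
have exr : exists m, (k <= m) && (f m \in D) by exists n; rewrite fn ltnW.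
(* [i] is the last visit to [D] before [k] and [j] the first one after; the hole meets [N] right
   after [i] and right before [j]. *)
case: (ex_maxnP exl ubl) => i /andP[le_ik fi] max_i.
case: (ex_minnP exr) => j /andP[le_kj fj] min_j.
have le_jn : j <= n by apply: min_j; rewrite fn ltnW.
have neq_k m : f m \in D :|: N -> m != k by apply: contraTneq => ->.
have lt_ik : i < k by rewrite ltn_neqAle le_ik neq_k // inE fi.
have lt_kj : k < j by rewrite ltn_neqAle le_kj eq_sym neq_k // inE fj.
have fi1 : f i.+1 \in N.
  have : f i.+1 \in D :|: N by apply: (DN (f i)); rewrite ?f_adj.
  rewrite inE => /orP[fiD | //].
  by have := max_i i.+1; rewrite lt_ik fiD ltnn => /(_ isT).
case: j => [//|j] in fj le_kj min_j le_jn lt_kj *.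
have fj1 : f j \in N.
  have : f j \in D :|: N by apply: (DN (f j.+1)); rewrite ?f_adj ?orbT.
  rewrite inE => /orP[fjD | //].
  by have := min_j j; rewrite -ltnS lt_kj fjD ltnn => /(_ isT).
have lt_i1k : i.+1 < k by rewrite ltn_neqAle lt_ik neq_k // inE fi1 orbT.
have lt_kj1 : k < j.
  by rewrite ltn_neqAle -ltnS lt_kj eq_sym neq_k // inE fj1 orbT.
have lt_ij : i.+2 < j by apply: leq_ltn_trans lt_kj1.
have lt_i1n : i.+1 < n by apply: ltn_trans lt_k.
(* The clique [N] makes these two vertices adjacent, but on the hole they are separated by index [k]
   on one side and index 0 on the other. *)
have := clN _ _ fi1 fj1; rewrite /f !modn_small //.
rewrite nth_uniq // neq_ltn (ltn_trans _ lt_ij) // => /(_ isT).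
rewrite hole_nth // -/n modn_small; last exact: leq_ltn_trans lt_k.
rewrite gtn_eqF //=.
move: le_jn; rewrite leq_eqVlt => /predU1P[-> | lt_j1].
  by rewrite modnn.
by rewrite modn_small // ltn_eqF // ltnS ltnW // ltnW.
Qed.

(** * Non-adjacent pairs of a potential maximal clique share a component *)

Lemma pmc_nonadjacent (V : finType) (e : rel V) (K : {set V}) x y :
    simple_graph e -> pmc e K -> x \in K -> y \in K -> x != y -> ~~ e x y ->
  exists D, [/\ D \in components e K, x \in nbh e D & y \in nbh e D].
Proof.
move=> [e_sym e_irr] [F [[[subF chF] minF] /maxsetP[clK _]]] xK yK xy nxy.
apply/'exists_and3P; apply: contraT => /existsPn noD.
have KF u w : u \in K -> w \in K -> u != w -> add_edges e F u w.
  move=> uK wK uw; move/forall_inP: clK => /(_ u uK)/forall_inP/(_ w wK).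
  by rewrite uw.
pose P (f : {set V}) := (f != [set x; y]) && ((f \subset K) ||
  [exists (D | D \in components e K), f \subset D :|: nbh e D]).
pose F' := [set f in F | P f].
(* The pair [xy] is a fill edge, since [K] is a clique of the completion, yet [P] rejects it; so
   [F' = F] is absurd. *)
suff FF' : F' = F.
  have : [set x; y] \in F' by rewrite FF'; have := KF x y xK yK xy; rewrite /add_edges /= (negPf nxy).
  by rewrite inE /P eqxx andbF.
have sF'F : F' \subset F by apply/subsetP=> f; rewrite inE => /andP[].
apply: minF => //; split; first exact: subset_trans sF'F subF.
set h := add_edges e F'.
have h_sym : symmetric h by move=> u w; rewrite /h /add_edges /= e_sym setUC.
have hK u w : u \in K -> w \in K -> u != w -> [set u; w] != [set x; y] -> h u w.
  move=> uK wK uw nf; have := KF u w uK wK uw; rewrite /h /add_edges /=; case: (e u w) => //= fF.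
  rewrite inE fF /P nf /=; apply/orP; left.
  by apply/subsetP=> z /set2P[]->.
have nbhK D u : D \in components e K -> u \in nbh e D -> u \in K.
  exact: nbh_component.
(* Otherwise [x] and [y], being in [K], would both lie in [nbh e D], against [noD]. *)
have not_xy D u w : D \in components e K -> u \in D :|: nbh e D ->
    w \in D :|: nbh e D -> [set u; w] != [set x; y].
  move=> DC uD wD; have := noD D; rewrite DC /=; apply: contra => /eqP fxy.
  have mem z : z \in K -> z \in [set x; y] -> z \in nbh e D.
    move=> zK; rewrite -fxy => /set2P zuw.
    have : z \in D :|: nbh e D by case: zuw => ->.
    by rewrite inE => /orP[/(component_notin DC)/negP[] |].
  by rewrite !mem // ?set21 ?set22.
have hD D u w : D \in components e K -> u \in D -> h u w -> w \in D :|: nbh e D.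
  move=> DC uD /orP[euw | ].
    by have /orP[|/andP[_]] := component_edge DC uD euw => wD; rewrite inE wD ?orbT.
  rewrite inE => /and3P[_ _ /orP[/subsetP/(_ u) | /existsP[D' /andP[DC' /subsetP fD']]]].
    by rewrite set21 (negPf (component_notin DC uD)) => /(_ isT).
  (* A kept fill edge at [u] outside [K] lies in some [D'] with its attachments; then [u] is in
     [D'], which forces [D' = D]. *)
  have uD' : u \in D'.
    have := fD' u; rewrite set21 => /(_ isT); rewrite inE => /orP[// | /nbhK-/(_ DC') uK].
    by have := component_notin DC uD; rewrite uK.
  by rewrite (component_uniq e_sym DC DC' uD uD') fD' // set22.
move=> c hc.
have [/hasP[d dc dK] | /hasPn cK] := boolP (has (fun z => z \notin K) c).
  have [D DC dD] := component_exists e dK.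
  have sub : {subset c <= D :|: nbh e D}.
    apply: (hole_attached_clique _ _ hc dc dD).
      by move=> u w uD; rewrite [h w u]h_sym orbb; apply: hD.
    move=> u w uD wD uw; apply: hK; rewrite ?(nbhK D) //.
    by apply: (not_xy D); rewrite // inE ?uD ?wD orbT.
  (* Every fill edge inside [D :|: nbh e D] was kept, so the hole survives in the chordal
     completion. *)
  apply: (chF c); apply: hole_eq_in hc => u w /sub uD /sub wD.
  rewrite /h /add_edges /= inE /P (not_xy D) //=; congr (_ || _).
  rewrite andb_idr // => _; apply/orP; right; apply/existsP; exists D.
  by rewrite DC; apply/subsetP=> z /set2P[]->.
have c4 : 4 <= size c by case: hc.
have uc : uniq c by case: hc => [[]].
(* The hole now lies in [K], where only [xy] can be a non-edge of [h]. Vertices 0, 2 and vertices 1,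
   3 are both non-adjacent pairs, so they would coincide. *)
have nh i : i < 2 -> [set nth x c i; nth x c i.+2] = [set x; y].
  move=> i2; have i2c : i.+2 < size c by apply: leq_trans c4.
  have ic : i < size c by do 2 apply: ltnW.
  apply/eqP; apply: contraT => nf.
  have := hK _ _ (negbNE (cK _ (mem_nth x ic))) (negbNE (cK _ (mem_nth x i2c))) _ nf.
  rewrite nth_uniq // ltn_eqF // => /(_ isT).
  rewrite (hole_nth _ hc) // modn_small; last exact: ltnW.
  rewrite gtn_eqF //=; move: i2c; rewrite leq_eqVlt => /predU1P[Ec | lt_c].
    by rewrite Ec modnn => /eqP i0; rewrite -Ec i0 in c4.
  by rewrite modn_small // ltn_eqF // !ltnS ltnW.
have : nth x c 0 \in [set nth x c 1; nth x c 3].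
  by rewrite (nh 1) // -(nh 0) // set21.
by rewrite !inE !nth_uniq // (leq_trans _ c4).
Qed.

(** * Covering a stable set by at most three components in a theta-free graph *)

Section StableCover.
Variables (V : finType) (e : rel V) (X Y : {set V}).
Hypotheses (e_sym : symmetric e) (e_irr : irreflexive e).
Hypothesis no_theta : ~ has_theta e.
Hypotheses (YX : Y \subset X) (stY : stable e Y).
Hypothesis covered : forall x y, x \in Y -> y \in Y -> x != y ->
  exists D, [/\ D \in components e X, x \in nbh e D & y \in nbh e D].

Let YE x y : x \in Y -> y \in Y -> ~~ e x y.
Proof. by move=> xY yY; move/forall_inP: stY => /(_ x xY)/forall_inP; apply. Qed.

Let inX x : x \in Y -> x \in X. Proof. exact: (subsetP YX). Qed.

(** The second set carries a route that enters [c] through [M] and leaves through [M']. *)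
Lemma route_anticomplete L M M' c : L \in components e X ->
    M \in components e X -> M' \in components e X -> c \in Y ->
    c \notin nbh e L -> L != M -> L != M' ->
  anticomplete e L (c |: (M :|: M')).
Proof.
move=> LC MC MC' cY cL LM LM'; apply: anticompleteUr.
  exact: component_anticomplete1 (inX cY) cL.
by apply: anticompleteUr; apply: (components_anticomplete e_sym LC).
Qed.

Lemma double_cover a b L L' c : a \in Y -> b \in Y -> a != b ->
    L \in components e X -> L' \in components e X -> L != L' ->
    a \in nbh e L -> b \in nbh e L -> a \in nbh e L' -> b \in nbh e L' ->
  c \in Y -> (c \in nbh e L) || (c \in nbh e L').
Proof.
move=> aY bY ab LC LC' LL' aL bL aL' bL' cY; apply: contraT.
rewrite negb_or => /andP[cL cL']; case: no_theta.
have nc z : z \in nbh e L -> z != c by apply: contraTneq => ->.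
have [M [MC aM cM]] := covered aY cY (nc _ aL).
have [M' [MC' bM' cM']] := covered bY cY (nc _ bL).
(* Attachment to [c] separates [M] and [M'] from [L] and [L']; [M] and [M'] may coincide. *)
have neq Q R : c \notin nbh e Q -> c \in nbh e R -> Q != R.
  by move=> cQ; apply: contraTneq => <-.
apply: (linked_theta e_sym e_irr ab (YE aY bY)
  (component_linked e_sym LC aL bL) (component_linked e_sym LC' aL' bL')
  (linked_trans (component_linked e_sym MC aM cM)
                (component_linked e_sym MC' cM' bM'))).
- exact: (components_anticomplete e_sym LC).
- by apply: route_anticomplete; rewrite ?neq.
- by apply: route_anticomplete; rewrite ?neq.
Qed.

Lemma single_cover a b c d L M M' :
    (forall x y D D', x \in Y -> y \in Y -> x != y ->
      D \in components e X -> D' \in components e X ->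
      x \in nbh e D -> y \in nbh e D -> x \in nbh e D' -> y \in nbh e D' ->
      D = D') ->
    a \in Y -> b \in Y -> a != b -> c \in Y -> d \in Y ->
    L \in components e X -> M \in components e X -> M' \in components e X ->
    a \in nbh e L -> b \in nbh e L -> c \notin nbh e L ->
    a \in nbh e M -> c \in nbh e M -> b \in nbh e M' -> c \in nbh e M' ->
  [|| d \in nbh e L, d \in nbh e M | d \in nbh e M'].
Proof.
move=> unique aY bY ab cY dY LC MC MC' aL bL cL aM cM bM' cM'.
apply: contraT; rewrite !negb_or => /and3P[dL dM dM']; case: no_theta.
have neq z Q R : z \notin nbh e Q -> z \in nbh e R -> Q != R.
  by move=> zQ; apply: contraTneq => <-.
have out z w Q : z \in nbh e Q -> w \notin nbh e Q -> z != w.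
  by move=> zQ; apply: contraNneq => <-.
have [N [NC aN dN]] := covered aY dY (out _ _ _ aL dL).
have [N' [NC' bN' dN']] := covered bY dY (out _ _ _ bL dL).
(* If [c] attached to [N], the pair [a], [c] would share [M] and [N]; uniqueness would give [M = N],
   so [d] would attach to [M]. *)
have cN : c \notin nbh e N.
  apply: contra dM => cN.
  by rewrite (unique a c M N) // (out _ _ _ aL cL).
have cN' : c \notin nbh e N'.
  apply: contra dM' => cN'.
  by rewrite (unique b c M' N') // (out _ _ _ bL cL).
apply: (linked_theta e_sym e_irr ab (YE aY bY)
  (component_linked e_sym LC aL bL)
  (linked_trans (component_linked e_sym MC aM cM)
                (component_linked e_sym MC' cM' bM'))
  (linked_trans (component_linked e_sym NC aN dN)
                (component_linked e_sym NC' dN' bN'))).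
- by apply: route_anticomplete; rewrite ?(neq c).
- by apply: route_anticomplete; rewrite ?(neq d).
(* The two routes: [c] and [d] are non-adjacent by stability, [c] misses [N] and [N'], [d] misses
   [M] and [M'], and hence the components differ. *)
apply: anticomplete_sym => //; apply: anticompleteUr.
  apply: anticomplete_sym => //; apply: anticompleteUr.
    move=> x y /set1P-> /set1P->; split; last exact: YE.
    exact: out cM dM.
  by apply: anticompleteUr; apply: anticomplete_sym => //;
    apply: (@component_anticomplete1 _ _ X); rewrite ?inX.
by apply: anticompleteUr; apply: anticomplete_sym => //;
  apply: route_anticomplete; rewrite // (neq d).
Qed.

Lemma stable_cover a b : a \in Y -> b \in Y -> a != b ->
  exists Ds : seq {set V}, [/\ size Ds <= 3, {subset Ds <= components e X}
    & forall y, y \in Y -> exists2 D, D \in Ds & y \in nbh e D].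
Proof.
move=> aY bY ab.
pose double (q : V * V * {set V} * {set V}) :=
  let: (x, y, D, D') := q in
  [&& x \in Y, y \in Y, x != y, D \in components e X, D' \in components e X,
    D != D', x \in nbh e D, y \in nbh e D, x \in nbh e D' & y \in nbh e D'].
(* Either some pair of [Y] shares two components, which then cover [Y], or shared components are
   unique. *)
case: (pickP double) => [[[[x y] D] D'] | nodouble].
  case/and5P=> xY yY xy DC /and5P[DC' DD' xD yD /andP[xD' yD']].
  exists [:: D; D']; split=> // [Q | c cY]; first by rewrite !inE => /orP[]/eqP->.
  have /orP[cD | cD] := double_cover xY yY xy DC DC' DD' xD yD xD' yD' cY.
    by exists D; rewrite // inE eqxx.
  by exists D'; rewrite // !inE eqxx orbT.
have unique x y D D' : x \in Y -> y \in Y -> x != y ->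
    D \in components e X -> D' \in components e X ->
    x \in nbh e D -> y \in nbh e D -> x \in nbh e D' -> y \in nbh e D' -> D = D'.
  move=> xY yY xy DC DC' xD yD xD' yD'; apply/eqP; apply: contraFT (nodouble (x, y, D, D')).
  by rewrite /= xY yY xy DC DC' xD yD xD' yD' => ->.
have [L [LC aL bL]] := covered aY bY ab.
have [YL | /subsetPn[c cY cL]] := boolP (Y \subset nbh e L).
  exists [:: L]; split=> // [Q | y yY]; first by rewrite inE => /eqP->.
  by exists L; rewrite ?(subsetP YL) ?mem_head.
have nc z : z \in nbh e L -> z != c by apply: contraTneq => ->.
have [M [MC aM cM]] := covered aY cY (nc _ aL).
have [M' [MC' bM' cM']] := covered bY cY (nc _ bL).
exists [:: L; M; M']; split=> // [Q | d dY].
  by rewrite !inE => /or3P[]/eqP->.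
have := single_cover unique aY bY ab cY dY LC MC MC' aL bL cL aM cM bM' cM'.
by case/or3P=> dD; [exists L | exists M | exists M'];
  rewrite // !inE eqxx ?orbT.
Qed.

End StableCover.

Unset Implicit Arguments.

(* [hY] excludes exactly the degenerate case where the conclusion cannot hold:
   Y = {y} where y has no neighbour outside chi v, as in a complete graph, where
   the bag is the whole vertex set and there are no components. For a stable set
   with at least two vertices (or none) [hY] is vacuously true. *)
Theorem theorem6p1 (V : finType) (e : rel V) (hG : simple_graph e)
    (hC : classC e)
    (T : finType) (t : rel T) (chi : T -> {set V})
    (hT : tree_decomposition e t chi) (hS : structured e chi)
    (v : T) (Y : {set V}) (hYsub : Y \subset chi v) (hYst : stable e Y)
    (hY : forall y : V, Y = [set y] -> ~~ (nbh e [set y] \subset chi v)) :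
  exists (k : nat) (D : 'I_k -> {set V}),
    [/\ k <= 4, forall i, D i \in components e (chi v)
      & Y \subset \bigcup_(i < k) nbh e (D i)].
Proof.
suff [Ds [sz DsC cov]] : exists Ds : seq {set V}, [/\ size Ds <= 4,
    {subset Ds <= components e (chi v)}
    & forall y, y \in Y -> exists2 D, D \in Ds & y \in nbh e D].
  exists (size Ds), (fun i => nth set0 Ds i); split=> // [i|].
    by apply: DsC; rewrite mem_nth.
  apply/subsetP=> y /cov[D DDs yD]; apply/bigcupP.
  have lt_D : index D Ds < size Ds by rewrite index_mem.
  by exists (Ordinal lt_D); rewrite //= nth_index.
have [e_sym e_irr] := hG.
have [-> | [a aY]] := set_0Vmem Y.
  by exists [::]; split=> // y; rewrite inE.
(* For a singleton, [hY] yields a neighbour of [a] outside the bag, and its component suffices;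
   otherwise [b] is a second vertex of [Y]. *)
have [Ya | /subsetPn[b bY]] := boolP (Y \subset [set a]).
  have Ea : Y = [set a] by apply/eqP; rewrite eqEsubset Ya sub1set.
  have /subsetPn[z] := hY a Ea; rewrite !inE => /andP[za /existsP[w]].
  case/andP=> /set1P-> eaz /(component_exists e)[D DC zD].
  exists [:: D]; split=> // [Q | y]; first by rewrite inE => /eqP->.
  rewrite Ea => /set1P->; exists D; rewrite ?inE //.
  apply/andP; split; last by apply/existsP; exists z; rewrite zD e_sym.
  by apply/negP=> /(component_notin DC)/negP[]; apply: (subsetP hYsub).
rewrite inE eq_sym => ab.
have [_ no_theta _ _] := hC.
have cov x y : x \in Y -> y \in Y -> x != y ->
    exists D, [/\ D \in components e (chi v), x \in nbh e D & y \in nbh e D].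
  move=> xY yY xy; apply: pmc_nonadjacent; rewrite ?(subsetP hYsub) //.
  by move/forall_inP: hYst => /(_ x xY)/forall_inP; apply.
have [Ds [sz DsC covDs]] := stable_cover e_sym e_irr no_theta hYsub hYst cov aY bY ab.
by exists Ds; split=> //; apply: leqW.
Qed.
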